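(* Let $\langle\mathcal{M},\mathbb{A},\in\rangle\models ZFA$ and let $S\in\mathcal{M}$ be a set of supports. Let $\mathcal{A},\mathcal{A}'\in\mathcal M$ be first-order structures on $\mathbb{A}$ with pure languages, and put $$\mathcal{N}:=PM(\mathcal{M},Aut(\mathcal{A}),\mathcal{F}^{Aut(\mathcal{A})}_S),\qquad \mathcal{N}':=PM(\mathcal{M},Aut(\mathcal{A}'),\mathcal{F}^{Aut(\mathcal{A}')}_S).$$ Then ($\mathcal{A}\in\mathcal{N}'$ and $\mathcal{A}'\in\mathcal{N}$) if and only if $\mathcal{N}=\mathcal{N}'$.
   Context: $ZFA$ is set theory with atoms in the language $\{\in,\mathbb{A}\}$ ($\mathbb{A}$ a unary predicate): the axioms of $ZF$ with extensionality restricted to non-atoms (''sets''), plus: atoms have no elements, and the atoms form a set, also denoted $\mathbb{A}$. All notions below are taken inside $\mathcal{M}$. Every $\pi\in Sym(\mathbb{A})$ (bijections of $\mathbb{A}$) extends to the universe by $\pi(x)=\{\pi(y):y\in x\}$ for sets $x$. For $G\leqslant Sym(\mathbb{A})$, $G_x=\{\pi\in G:\pi(x)=x\}$. $TC(x)$ is the transitive closure of $x$. A normal filter $\mathcal F$ of subgroups of $G$ is a nonempty set of subgroups of $G$, closed under supergroups within $G$, finite intersections and conjugation by elements of $G$, with $G_a\in\mathcal F$ for all $a\in\mathbb{A}$. An element $x$ is symmetric w.r.t. $\mathcal{F}$ if $G_x\in\mathcal F$, and hereditarily symmetric if every $y\in TC(\{x\})$ is symmetric. $PM(\mathcal{M},G,\mathcal{F})$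 is the class of all hereditarily symmetric $x\in\mathcal M$. For a set $S$ and $G\leqslant Sym(\mathbb{A})$, $\mathcal{F}^G_S$ is the set of subgroups of $G$ that contain a finite intersection of groups of the form $G_x$, $x\in S$ (defined when this is a normal filter of subgroups of $G$). $S$ is a set of supports if $\mathcal{F}^G_S$ is a normal filter for every $G\leqslant Sym(\mathbb{A})$. A set is pure if neither it nor any element of its transitive closure is an atom. A structure is regarded as a function from its language (set of symbols) to its predicates; it has pure language if its language is a pure set. *)

(* Defs.v *)
(* Plain Rocq, no library beyond the prelude.

   M is an arbitrary model of the first-order theory ZFA, possibly ill-founded
   from outside, so separation and replacement range over the (deeply embedded)
   first-order formulas with parameters, and every set-theoretic notion below
   is interpreted inside M: its quantifiers range over elements of M.
   Classes of M are predicates M -> Prop. *)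

Set Implicit Arguments.

Record structure := Structure {
  carrier :> Type;
  mem : carrier -> carrier -> Prop;
  atom : carrier -> Prop
}.
Arguments mem {s} _ _.
Arguments atom {s} _.

Notation "x ∈ y" := (mem x y) (at level 70, no associativity).
Notation "x ∉ y" := (~ mem x y) (at level 70, no associativity).

(* First-order formulas of the language {∈, 𝔸} with equality; variables are
   de Bruijn indices, the quantifiers binding index 0. *)
Inductive formula :=
| fMem (i j : nat)
| fEq (i j : nat)
| fAtom (i : nat)
| fFalse
| fAnd (p q : formula)
| fOr (p q : formula)
| fImp (p q : formula)
| fAll (p : formula)
| fEx (p : formula).

Definition scons {T : Type} (x : T) (e : nat -> T) : nat -> T :=
  fun n => match n with 0 => x | S k => e k end.

Fixpoint sat {M : structure} (e : nat -> M) (p : formula) : Prop :=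
  match p with
  | fMem i j => e i ∈ e j
  | fEq i j => e i = e j
  | fAtom i => atom (e i)
  | fFalse => False
  | fAnd p q => sat e p /\ sat e q
  | fOr p q => sat e p \/ sat e q
  | fImp p q => sat e p -> sat e q
  | fAll p => forall x : M, sat (scons x e) p
  | fEx p => exists x : M, sat (scons x e) p
  end.

Definition el {M : structure} (s : M) : M -> Prop := fun x => x ∈ s.

(* s is the set {x | P x}; in particular it is not an atom. *)
Definition is_setof {M : structure} (P : M -> Prop) (s : M) : Prop :=
  ~ atom s /\ forall x : M, x ∈ s <-> P x.

(* w contains the empty set and is closed under x ↦ x ∪ {x}. *)
Definition inductive {M : structure} (w : M) : Prop :=
  (exists z, z ∈ w /\ is_setof (fun _ => False) z) /\
  forall x, x ∈ w -> exists y, y ∈ w /\ is_setof (fun v => v ∈ x \/ v = x) y.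

Record ZFA (M : structure) : Prop := {
  zfa_extensionality : forall x y : M, ~ atom x -> ~ atom y ->
    (forall z, z ∈ x <-> z ∈ y) -> x = y;
  zfa_atoms_empty : forall a x : M, atom a -> x ∉ a;
  zfa_set_of_atoms : exists s : M, is_setof atom s;
  zfa_pairing : forall x y : M, exists s, is_setof (fun z => z = x \/ z = y) s;
  zfa_union : forall x : M, exists s,
    is_setof (fun z => exists y, y ∈ x /\ z ∈ y) s;
  zfa_powerset : forall x : M, exists s,
    is_setof (fun y => ~ atom y /\ forall z, z ∈ y -> z ∈ x) s;
  zfa_infinity : exists w : M, inductive w;
  zfa_foundation : forall x : M, (exists y, y ∈ x) ->
    exists y, y ∈ x /\ forall z, z ∈ x -> z ∉ y;
  zfa_separation : forall (p : formula) (e : nat -> M) (x : M), exists s,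
    is_setof (fun z => z ∈ x /\ sat (scons z e) p) s;
  zfa_replacement : forall (p : formula) (e : nat -> M) (x : M),
    (forall u v w, u ∈ x -> sat (scons u (scons v e)) p ->
       sat (scons u (scons w e)) p -> v = w) ->
    exists s,
      is_setof (fun v => exists u, u ∈ x /\ sat (scons u (scons v e)) p) s
}.

Definition is_nat {M : structure} (n : M) : Prop :=
  forall w : M, inductive w -> n ∈ w.

Definition is_upair {M : structure} (x y u : M) : Prop :=
  is_setof (fun z => z = x \/ z = y) u.

(* Kuratowski pairs: p = {{x}, {x, y}}. *)
Definition is_pair {M : structure} (x y p : M) : Prop :=
  exists u v, is_upair x x u /\ is_upair x y v /\ is_upair u v p.

(* (x, y) ∈ f *)
Definition app {M : structure} (f x y : M) : Prop :=
  exists p, p ∈ f /\ is_pair x y p.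

Definition is_fun {M : structure} (f : M) (X Y : M -> Prop) : Prop :=
  ~ atom f /\
  (forall p, p ∈ f -> exists x y, X x /\ Y y /\ is_pair x y p) /\
  forall x, X x -> exists! y, app f x y.

Definition is_bij {M : structure} (f : M) (X Y : M -> Prop) : Prop :=
  is_fun f X Y /\
  (forall x x' y, app f x y -> app f x' y -> x = x') /\
  forall y, Y y -> exists x, app f x y.

Definition is_finite {M : structure} (D : M) : Prop :=
  ~ atom D /\ exists n f, is_nat n /\ is_bij f (el n) (el D).

Definition is_id {M : structure} (i : M) : Prop :=
  is_setof (fun p => exists a, atom a /\ is_pair a a p) i.

(* h = f ∘ g *)
Definition is_comp {M : structure} (f g h : M) : Prop :=
  is_setof
    (fun p => exists x y z, app g x y /\ app f y z /\ is_pair x z p) h.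

Definition is_inv {M : structure} (f g : M) : Prop :=
  is_setof (fun p => exists x y, app f x y /\ is_pair y x p) g.

Definition transitive {M : structure} (t : M) : Prop :=
  forall x y, x ∈ t -> y ∈ x -> y ∈ t.

(* y ∈ TC({x}), the least transitive set that has x as an element. *)
Definition in_TC {M : structure} (x y : M) : Prop :=
  forall t, transitive t -> x ∈ t -> y ∈ t.

Definition pure {M : structure} (x : M) : Prop :=
  forall y, in_TC x y -> ~ atom y.

Definition is_sym {M : structure} (pi : M) : Prop := is_bij pi atom atom.

(* π(x) = y, by recursion on ∈: some f in M whose domain is a transitive set D
   containing x satisfies f(a) = π(a) for atoms a ∈ D and
   f(z) = {f(u) : u ∈ z} for sets z ∈ D, and f(x) = y. *)
Definition act {M : structure} (pi x y : M) : Prop :=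
  exists D f, transitive D /\ x ∈ D /\ is_fun f (el D) (fun _ => True) /\
    (forall z w, app f z w ->
       (atom z -> app pi z w) /\
       (~ atom z -> is_setof (fun v => exists u, u ∈ z /\ app f u v) w)) /\
    app f x y.

(* G is a subgroup of Sym(𝔸). *)
Definition is_group {M : structure} (G : M -> Prop) : Prop :=
  (forall p, G p -> is_sym p) /\
  (exists i, is_id i /\ G i) /\
  (forall p q, G p -> G q -> exists r, is_comp p q r /\ G r) /\
  (forall p, G p -> exists q, is_inv p q /\ G q).

(* Subgroups of G that are elements of M. *)
Definition subgroup {M : structure} (G : M -> Prop) (H : M) : Prop :=
  ~ atom H /\ (forall p, p ∈ H -> G p) /\ is_group (el H).

Definition stab {M : structure} (G : M -> Prop) (x : M) : M -> Prop :=
  fun p => G p /\ act p x x.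

(* {x | P x} is a set of M and belongs to F. *)
Definition contains {M : structure} (F P : M -> Prop) : Prop :=
  exists s, is_setof P s /\ F s.

(* s = p q p⁻¹ *)
Definition is_conj {M : structure} (p q s : M) : Prop :=
  exists p' r, is_inv p p' /\ is_comp p q r /\ is_comp r p' s.

Definition normal_filter {M : structure} (G F : M -> Prop) : Prop :=
  (exists H, F H) /\
  (forall H, F H -> subgroup G H) /\
  (forall H K, F H -> subgroup G K -> (forall p, p ∈ H -> p ∈ K) -> F K) /\
  (forall D, is_finite D -> (forall H, H ∈ D -> F H) ->
     contains F (fun p => G p /\ forall H, H ∈ D -> p ∈ H)) /\
  (forall p H, G p -> F H ->
     contains F (fun s => exists q, q ∈ H /\ is_conj p q s)) /\
  (forall a, atom a -> contains F (stab G a)).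

Definition symmetric {M : structure} (G F : M -> Prop) (x : M) : Prop :=
  contains F (stab G x).

Definition PM {M : structure} (G F : M -> Prop) (x : M) : Prop :=
  forall y, in_TC x y -> symmetric G F y.

(* ℱ^G_S. The empty intersection of subgroups of G is G. *)
Definition supp_filter {M : structure} (G : M -> Prop) (S : M) : M -> Prop :=
  fun H => subgroup G H /\
    exists E, is_finite E /\ (forall x, x ∈ E -> x ∈ S) /\
      forall p, G p -> (forall x, x ∈ E -> stab G x p) -> p ∈ H.

Definition set_of_supports {M : structure} (S : M) : Prop :=
  ~ atom S /\
  forall G : M, ~ atom G -> is_group (el G) ->
    normal_filter (el G) (supp_filter (el G) S).

(* Finite tuples of atoms are functions from a natural number to 𝔸. *)
Definition is_predicate {M : structure} (P : M) : Prop :=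
  ~ atom P /\ exists n, is_nat n /\ forall t, t ∈ P -> is_fun t (el n) atom.

(* A is a first-order structure on 𝔸 with language L. *)
Definition is_structure {M : structure} (L A : M) : Prop :=
  ~ atom L /\ is_fun A (el L) is_predicate.

Definition pure_structure {M : structure} (A : M) : Prop :=
  exists L, is_structure L A /\ pure L.

(* A permutation p of 𝔸 sends a tuple t to p ∘ t. *)
Definition Aut {M : structure} (A : M) : M -> Prop :=
  fun p => is_sym p /\
    forall R P n t t', app A R P -> is_nat n -> is_fun t (el n) atom ->
      is_comp p t t' -> (t ∈ P <-> t' ∈ P).

(* Main.v *)
(** A permutation of the atoms fixes a structure with pure language if and only
    if it is an automorphism of it. If [A] is symmetric in [N'], some finite
    [E ⊆ S] has all its pointwise stabilizer in [Aut A'] contained in [Aut A];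
    enlarging supports by [E] then makes every set symmetric for [Aut A]
    symmetric for [Aut A']. Conversely [A] always lies in its own permutation
    model: the predicates of [A] are invariant under [Aut A], and a finite tuple
    is supported by the intersection of the stabilizers of its entries, so [N = N']
    places each structure in the model of the other. *)

Require Import Defs.
From Stdlib Require Import ssreflect Arith Classical ClassicalEpsilon FunctionalExtensionality PropExtensionality.

Set Implicit Arguments.
Unset Strict Implicit.

(** * Definable classes *)

(** Seen from outside, M may be ill-founded and have nonstandard natural numbers, so no induction or
    recursion of Rocq runs over its elements. The only tools are the schemes of separation and
    replacement, which accept formulas. Every class that enters a comprehension or an induction is
    therefore certified [definable], and natural numbers, transitive supersets and the action on
    sets are all constructed inside M. A second mismatch is that [set_of_supports] speaks of groups
    that are elements of M, while [Aut A] is a class; it is first realized as a set [g]. A third is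
    that [Aut] moves tuples by composition, while stabilizers use the recursive action; the two
    agree because the indices of a tuple are pure. *)

Section Definability.

Context {M : structure}.
Implicit Types (e : nat -> M) (p q : formula).

Lemma sat_ext p e e' : (forall i, e i = e' i) -> sat e p <-> sat e' p.
Proof.
elim: p e e' => /= [i j|i j|i||p IHp q IHq|p IHp q IHq|p IHp q IHq|p IHp|p IHp] e e' ee'.
- by rewrite !ee'.
- by rewrite !ee'.
- by rewrite !ee'.
- by [].
- by rewrite (IHp _ _ ee') (IHq _ _ ee').
- by rewrite (IHp _ _ ee') (IHq _ _ ee').
- by rewrite (IHp _ _ ee') (IHq _ _ ee').
- have E x : sat (scons x e) p <-> sat (scons x e') p by apply: IHp => -[].
  by split=> H x; apply/E.
- have E x : sat (scons x e) p <-> sat (scons x e') p by apply: IHp => -[].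
  by split=> -[x H]; exists x; apply/E.
Qed.

Definition lift (f : nat -> nat) (n : nat) : nat :=
  match n with 0 => 0 | S k => S (f k) end.

Fixpoint rename (f : nat -> nat) p : formula :=
  match p with
  | fMem i j => fMem (f i) (f j)
  | fEq i j => fEq (f i) (f j)
  | fAtom i => fAtom (f i)
  | fFalse => fFalse
  | fAnd p q => fAnd (rename f p) (rename f q)
  | fOr p q => fOr (rename f p) (rename f q)
  | fImp p q => fImp (rename f p) (rename f q)
  | fAll p => fAll (rename (lift f) p)
  | fEx p => fEx (rename (lift f) p)
  end.

Lemma sat_rename p f e : sat e (rename f p) <-> sat (fun i => e (f i)) p.
Proof.
elim: p f e => /= [i j|i j|i||p IHp q IHq|p IHp q IHq|p IHp q IHq|p IHp|p IHp] f e //.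
- by rewrite IHp IHq.
- by rewrite IHp IHq.
- by rewrite IHp IHq.
- have E x : sat (scons x e) (rename (lift f) p) <-> sat (scons x (fun i => e (f i))) p.
    by rewrite IHp; apply: sat_ext => -[].
  by split=> H x; apply/E.
- have E x : sat (scons x e) (rename (lift f) p) <-> sat (scons x (fun i => e (f i))) p.
    by rewrite IHp; apply: sat_ext => -[].
  by split=> -[x H]; exists x; apply/E.
Qed.

(** The syntax of formulas has no constants, so a free variable is given a slot: [inl] refers to the
    environment, [inr] holds a parameter from M. *)
Definition tval e (s : nat + M) : M :=
  match s with inl k => e k | inr a => a end.

(* A predicate on environments is definable if it is given by a formula whose
   free variables stand for entries of the environment or for parameters. *)
Definition definable (P : (nat -> M) -> Prop) : Prop :=
  exists p (s : nat -> nat + M), forall e, sat (fun i => tval e (s i)) p <-> P e.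

Definition term (t : (nat -> M) -> M) : Prop :=
  exists s, forall e, t e = tval e s.

Lemma term_var i : term (fun e => e i).
Proof. by exists (inl i). Qed.

Lemma term_const a : term (fun _ => a).
Proof. by exists (inr a). Qed.

(** Needed when a term passes below a quantifier, where the entries of the outer environment are
    reindexed. *)
Lemma term_shift t (f : nat -> nat) : term t -> term (fun e => t (fun n => e (f n))).
Proof.
move=> [s hs]; exists (match s with inl k => inl (f k) | inr a => inr a end) => e.
by rewrite hs; case: s {hs}.
Qed.

Lemma definable_mem t u : term t -> term u -> definable (fun e => t e ∈ u e).
Proof.
move=> [s hs] [r hr]; exists (fMem 0 1), (fun i => match i with 0 => s | _ => r end) => e.
by rewrite /= hs hr.
Qed.

Lemma definable_eq t u : term t -> term u -> definable (fun e => t e = u e).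
Proof.
move=> [s hs] [r hr]; exists (fEq 0 1), (fun i => match i with 0 => s | _ => r end) => e.
by rewrite /= hs hr.
Qed.

Lemma definable_atom t : term t -> definable (fun e => atom (t e)).
Proof. by move=> [s hs]; exists (fAtom 0), (fun _ => s) => e; rewrite /= hs. Qed.

Lemma definable_false : definable (fun _ => False).
Proof. by exists fFalse, (fun i => inl i). Qed.

Lemma definable_true : definable (fun _ => True).
Proof. by exists (fImp fFalse fFalse), (fun i => inl i) => e; split=> // _ []. Qed.

(** The two formulas come with unrelated slot assignments. Moving the variables of one to even
    indices and those of the other to odd indices lets a single assignment serve both. *)
Lemma definable_pair P Q : definable P -> definable Q ->
  exists p q s, forall e,
    (sat (fun i => tval e (s i)) p <-> P e) /\ (sat (fun i => tval e (s i)) q <-> Q e).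
Proof.
move=> [p [s hp]] [q [r hq]].
exists (rename (fun i => 2 * i) p), (rename (fun i => S (2 * i)) q).
exists (fun i => if Nat.even i then s (Nat.div2 i) else r (Nat.div2 i)) => e.
rewrite !sat_rename -hp -hq; split; apply: sat_ext => i.
- by rewrite Nat.even_even Nat.div2_double.
- by rewrite Nat.div2_succ_double Nat.even_succ -Nat.negb_even Nat.even_even.
Qed.

Lemma definable_and P Q : definable P -> definable Q -> definable (fun e => P e /\ Q e).
Proof.
move=> dP dQ; have [p [q [s h]]] := definable_pair dP dQ.
by exists (fAnd p q), s => e /=; have [-> ->] := h e.
Qed.

Lemma definable_or P Q : definable P -> definable Q -> definable (fun e => P e \/ Q e).
Proof.
move=> dP dQ; have [p [q [s h]]] := definable_pair dP dQ.
by exists (fOr p q), s => e /=; have [-> ->] := h e.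
Qed.

Lemma definable_imp P Q : definable P -> definable Q -> definable (fun e => P e -> Q e).
Proof.
move=> dP dQ; have [p [q [s h]]] := definable_pair dP dQ.
by exists (fImp p q), s => e /=; have [-> ->] := h e.
Qed.

Lemma definable_iff P Q : definable P -> definable Q -> definable (fun e => P e <-> Q e).
Proof. by move=> dP dQ; apply: definable_and; apply: definable_imp. Qed.

(** Several variables of the formula may share the slot [inl 0] of the quantified entry. All of them
    are renamed to the de Bruijn index 0, and every other variable moves up by one. *)
Lemma definable_binder (Q : M -> (nat -> M) -> Prop) :
  definable (fun e => Q (e 0) (fun n => e (S n))) ->
  exists p s, forall e x, sat (scons x (fun i => tval e (s i))) p <-> Q x e.
Proof.
move=> [p [s hp]].
exists (rename (fun i => match s i with inl 0 => 0 | _ => S i end) p).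
exists (fun i => match s i with inl (S k) => inl k | t => t end) => e x.
rewrite sat_rename -(hp (scons x e)); apply: sat_ext => i.
by case E: (s i) => [[|k]|a]; rewrite /= ?E.
Qed.

Lemma definable_all (Q : M -> (nat -> M) -> Prop) :
  definable (fun e => Q (e 0) (fun n => e (S n))) -> definable (fun e => forall x, Q x e).
Proof.
move=> /definable_binder [p [s h]]; exists (fAll p), s => e /=.
by split=> H x; apply/h.
Qed.

Lemma definable_ex (Q : M -> (nat -> M) -> Prop) :
  definable (fun e => Q (e 0) (fun n => e (S n))) -> definable (fun e => exists x, Q x e).
Proof.
move=> /definable_binder [p [s h]]; exists (fEx p), s => e /=.
by split=> -[x H]; exists x; apply/h.
Qed.

Definition definable1 (P : M -> Prop) := definable (fun e => P (e 0)).
Definition definable2 (R : M -> M -> Prop) := definable (fun e => R (e 0) (e 1)).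

(** Brings a definable class into the shape that the axiom scheme expects. Since [P] reads entry 0
    only, the other entries can be filled with the default [x0]. *)
Lemma definable1_sat P (x0 : M) : definable1 P ->
  exists p e, forall x, sat (scons x e) p <-> P x.
Proof.
move=> [p [s hp]].
exists (rename (fun i => match s i with inl 0 => 0 | _ => S i end) p).
exists (fun i => tval (fun _ => x0) (s i)) => x.
rewrite sat_rename -(hp (scons x (fun _ => x0))); apply: sat_ext => i.
by case E: (s i) => [[|k]|a]; rewrite /= ?E.
Qed.

Lemma definable2_sat R (x0 : M) : definable2 R ->
  exists p e, forall x y, sat (scons x (scons y e)) p <-> R x y.
Proof.
move=> [p [s hp]].
exists (rename (fun i => match s i with inl 0 => 0 | inl 1 => 1 | _ => S (S i) end) p).
exists (fun i => tval (fun _ => x0) (s i)) => x y.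
rewrite sat_rename -(hp (scons x (scons y (fun _ => x0)))); apply: sat_ext => i.
by case E: (s i) => [[|[|k]]|a]; rewrite /= ?E.
Qed.

End Definability.

Definition is_succ {M : structure} (x y : M) : Prop :=
  is_setof (fun v => v ∈ x \/ v = x) y.

Ltac definable_step :=
  first [ apply term_var | apply term_const
        | match goal with h : term ?t |- term (fun e => ?t (fun n => @?g e n)) => refine (term_shift _ h) end
        | assumption
        | apply definable_mem | apply definable_eq | apply definable_atom
        | apply definable_false | apply definable_true | apply definable_and | apply definable_or
        | apply definable_iff | apply definable_imp | apply definable_all | apply definable_ex ].

Lemma definable_is_pair {M : structure} (x y p : (nat -> M) -> M) :
  term x -> term y -> term p -> definable (fun e => is_pair (x e) (y e) (p e)).
Proof. by move=> *; unfold is_pair, is_upair, is_setof, not; repeat (cbn beta; definable_step). Qed.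

Lemma definable_app {M : structure} (f x y : (nat -> M) -> M) :
  term f -> term x -> term y -> definable (fun e => app (f e) (x e) (y e)).
Proof.
by move=> *; unfold app; repeat (cbn beta; first [apply definable_is_pair | definable_step]).
Qed.

Lemma definable_act {M : structure} (p x y : (nat -> M) -> M) :
  term p -> term x -> term y -> definable (fun e => act (p e) (x e) (y e)).
Proof.
by move=> *; unfold act, transitive, is_fun, is_setof, el, unique, not;
   repeat (cbn beta; first [apply definable_is_pair | apply definable_app | definable_step]).
Qed.

(** [is_pair], [app] and [act] stay folded, so that their definability lemmas are reused instead of
    being reproved at each occurrence. *)
Ltac definable :=
  unfold definable1, definable2, symmetric, contains, supp_filter, stab, subgroup, is_group, Aut, pure,
    in_TC, transitive, is_finite, is_sym, is_bij, is_fun, is_id, is_comp, is_inv, is_nat, inductive,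
    is_succ, is_upair, is_setof, el, unique, not;
  repeat (cbn beta;
    first [ apply definable_act | apply definable_app | apply definable_is_pair | definable_step ]).

(** * Sets, pairs and functions *)

Section SetTheory.

Context {M : structure} (hM : ZFA M).
Implicit Types (x y z u v w a b f g n t i j k D E G H p q r s : M).

Lemma set_ext P Q x y : is_setof P x -> is_setof Q y -> (forall z, P z <-> Q z) -> x = y.
Proof.
move=> [ax hx] [ay hy] PQ; apply: (zfa_extensionality hM) => // z.
by rewrite hx hy.
Qed.

Lemma separation P x : definable1 P -> exists s, is_setof (fun z => z ∈ x /\ P z) s.
Proof.
move=> /(definable1_sat x) [p [e h]].
have [s [as_ hs]] := zfa_separation hM p e x.
by exists s; split=> // z; rewrite hs h.
Qed.

Lemma replacement R x : definable2 R ->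
  (forall u v w, u ∈ x -> R u v -> R u w -> v = w) ->
  exists s, is_setof (fun v => exists u, u ∈ x /\ R u v) s.
Proof.
move=> /(definable2_sat x) [p [e h]] Rf.
have [|s [as_ hs]] := @zfa_replacement _ hM p e x.
  by move=> u v w ux /h Ruv /h; apply: Rf Ruv.
exists s; split=> // v; rewrite hs.
by split=> -[u [ux /h Ru]]; exists u.
Qed.

(** Choice at the level of Rocq names the set so that equations can be rewritten. Such a name is not
    a term of the object language, so properties shown to be definable keep using the relations
    [is_upair] and [is_pair]. *)
Definition upair x y : M := epsilon (inhabits x) (is_upair x y).
Definition pair x y : M := upair (upair x x) (upair x y).

Lemma upairP x y : is_upair x y (upair x y).
Proof. exact: epsilon_spec (zfa_pairing hM x y). Qed.

Lemma upairE x y s : is_upair x y s <-> s = upair x y.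
Proof.
split=> [h | ->]; last exact: upairP.
exact: set_ext h (upairP x y) _.
Qed.

Lemma in_upair x y z : z ∈ upair x y <-> z = x \/ z = y.
Proof. by case: (upairP x y). Qed.

Lemma upair_nonatom x y : ~ atom (upair x y).
Proof. by case: (upairP x y). Qed.

Lemma pairE x y s : is_pair x y s <-> s = pair x y.
Proof.
split=> [[u [v [/upairE -> [/upairE -> /upairE ->]]]] // | ->].
by exists (upair x x), (upair x y); rewrite !upairE.
Qed.

Lemma upair_inj x y y' : upair x y = upair x y' -> y = y'.
Proof.
move=> e; have : y ∈ upair x y' by rewrite -e in_upair; right.
rewrite in_upair => -[yx|//].
have : y' ∈ upair x y by rewrite e in_upair; right.
by rewrite in_upair yx => -[->|->].
Qed.

Lemma pair_inj x y x' y' : pair x y = pair x' y' -> x = x' /\ y = y'.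
Proof.
move=> e; have xx' : x = x'.
  have : upair x' x' ∈ pair x y by rewrite e in_upair; left.
  rewrite in_upair => -[] e'; have : x ∈ upair x' x' by rewrite e' in_upair; left.
    by rewrite in_upair => -[].
  by rewrite in_upair => -[].
split=> //; move: e; rewrite -xx' => /upair_inj; exact: upair_inj.
Qed.

Lemma pair_nonatom x y : ~ atom (pair x y).
Proof. exact: upair_nonatom. Qed.

Lemma appE f x y : app f x y <-> pair x y ∈ f.
Proof.
split=> [[p [pf /pairE <-]] // | h].
by exists (pair x y); split=> //; apply/pairE.
Qed.

Lemma fun_dom f X Y x y : is_fun f X Y -> app f x y -> X x /\ Y y.
Proof.
move=> [_ [h _]] /appE /h [x' [y' [Xx [Yy /pairE /pair_inj [-> ->]]]]].
by split.
Qed.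

Lemma fun_total f X Y x : is_fun f X Y -> X x -> exists y, app f x y.
Proof. by move=> [_ [_ h]] /h [y [? _]]; exists y. Qed.

Lemma fun_functional f X Y x y y' : is_fun f X Y -> app f x y -> app f x y' -> y = y'.
Proof.
move=> hf h; have [Xx _] := fun_dom hf h; case: hf => _ [_ /(_ x Xx) [y0 [_ un]]].
by move/un: h => <- /un ->.
Qed.

Lemma in_fun f X Y r : is_fun f X Y -> r ∈ f <-> exists x y, r = pair x y /\ app f x y.
Proof.
move=> [_ [h _]]; split=> [rf|[x [y [-> /appE //]]]].
have [x [y [_ [_ /pairE e]]]] := h _ rf.
by exists x, y; rewrite appE -e.
Qed.

(** Replacement is applied to the map sending [x] to the pair of [x] and its value. The set [D]
    certifies that the domain [X], which [is_fun] takes as a class, is a set of M. *)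
Lemma fun_of_graph D (X Y : M -> Prop) (R : M -> M -> Prop) : (forall x, x ∈ D <-> X x) ->
  definable2 R ->
  (forall x y y', X x -> R x y -> R x y' -> y = y') ->
  (forall x, X x -> exists y, Y y /\ R x y) ->
  exists f, is_fun f X Y /\ forall x y, app f x y <-> X x /\ R x y.
Proof.
move=> hD dR Rf Rt.
have [||f [af hf]] := @replacement (fun x r => exists y, R x y /\ is_pair x y r) D.
{ case: dR => p [s h].
  pose Q (y : M) (e : nat -> M) := R (e 0) y /\ is_pair (e 0) y (e 1).
  apply: (@definable_ex _ Q); apply: definable_and; last by definable.
  have [p' [e' h']] := definable2_sat D (ex_intro _ p (ex_intro _ s h)).
  (* Below the quantifier over [y] the arguments of [R] sit at entries 1 and 0, in the order
     opposite to [definable2]; the first two slots are swapped and the rest become parameters. *)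
  exists p', (fun i : nat => match i with 0 => inl 1 | 1 => inl 0 | S (S k) => inr (e' k) end) => e.
  by rewrite -h'; apply: sat_ext => -[|[|k]]. }
{ move=> u v w /hD Xu [y [Ry /pairE ->]] [y' [Ry' /pairE ->]].
  by rewrite (Rf _ _ _ Xu Ry Ry'). }
have appf x y : app f x y <-> X x /\ R x y.
{ rewrite appE hf; split=> [[u [/hD Xu [y' [Ry' /pairE /pair_inj [-> ->]]]]]|[Xx Rxy]].
  - by split.
  - by exists x; split; [apply/hD|exists y; rewrite pairE]. }
exists f; split=> //; split=> //; split=> [r /hf [x [/hD Xx [y [Rxy /pairE ->]]]]|x Xx].
- have [y' [Yy' Rxy']] := Rt _ Xx.
  by exists x, y; rewrite pairE (Rf _ _ _ Xx Rxy Rxy').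
- have [y [Yy Rxy]] := Rt _ Xx; exists y; split; first by apply/appf.
  by move=> y' /appf [_]; apply: Rf.
Qed.

(** * Foundation, natural numbers and transitive closures *)

Lemma foundation_set P D x : definable1 P -> x ∈ D -> P x ->
  exists y, y ∈ D /\ P y /\ forall z, z ∈ D -> z ∈ y -> ~ P z.
Proof.
move=> dP xD Px; have [s [_ hs]] := separation D dP.
have [|y [/hs [yD Py] hy]] := zfa_foundation hM s; first by exists x; apply/hs.
exists y; do 2!split=> //; move=> z zD zy Pz.
by apply: (hy z) => //; apply/hs.
Qed.

Lemma mem_irrefl x : x ∉ x.
Proof.
move=> xx; have [|y []] := zfa_foundation hM (upair x x); first by exists x; rewrite in_upair; left.
by rewrite in_upair => -[->|->] /(_ x); apply; rewrite ?in_upair; auto.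
Qed.

Lemma mem_asym x y : x ∈ y -> y ∈ x -> False.
Proof.
move=> xy yx; have [|z []] := zfa_foundation hM (upair x y); first by exists x; rewrite in_upair; left.
by rewrite in_upair => -[->|->] h; [apply: (h y)|apply: (h x)]; rewrite ?in_upair; auto.
Qed.

Lemma adjoin_ex D x : exists s, is_setof (fun v => v ∈ D \/ v = x) s.
Proof.
have [s [as_ hs]] := zfa_union hM (upair D (upair x x)).
exists s; split=> // v; rewrite hs; split=> [[y [/in_upair [->|->]]]|[vx|->]].
- by left.
- by rewrite in_upair => -[]; right.
- by exists D; rewrite in_upair; split=> //; left.
- by exists (upair x x); rewrite !in_upair; split; [right|left].
Qed.

Lemma succ_ex x : exists y, is_succ x y.
Proof. exact: adjoin_ex. Qed.

(** Two different predecessors would be elements of each other. *)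
Lemma succ_inj x x' y : is_succ x y -> is_succ x' y -> x = x'.
Proof.
move=> [_ h] [_ h'].
have : x ∈ y by apply/h; right.
have : x' ∈ y by apply/h'; right.
move=> /h [x'x|//] /h' [xx'|//]; case: (mem_asym xx' x'x).
Qed.

Lemma nat_zero z : is_setof (fun _ => False) z -> is_nat z.
Proof. by move=> hz w [[z' [z'w hz']] _]; rewrite (set_ext hz hz'). Qed.

Lemma nat_succ n m : is_nat n -> is_succ n m -> is_nat m.
Proof.
move=> hn hm w hw; have [_ h] := hw; have [m' [m'w hm']] := h _ (hn _ hw).
by rewrite (set_ext hm hm').
Qed.

Lemma omega_ex : exists w, forall n, n ∈ w <-> is_nat n.
Proof.
have [w hw] := zfa_infinity hM.
have [|s [_ hs]] := @separation (@is_nat M) w; first by definable.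
by exists s => n; rewrite hs; split=> [[]|h] //; split=> //; apply: h.
Qed.

(** The natural numbers satisfying [P] form an inductive set of M, and a natural number lies in
    every inductive set. *)
Lemma nat_ind P : definable1 P -> (forall z, is_setof (fun _ => False) z -> P z) ->
  (forall n m, is_nat n -> P n -> is_succ n m -> P m) -> forall n, is_nat n -> P n.
Proof.
move=> dP P0 PS; have [w hw] := omega_ex.
have [s [as_ hs]] := separation w dP.
move=> n hn; suff : n ∈ s by move=> /hs [].
apply: hn.
have [w0 [[z [_ hz]] _]] := zfa_infinity hM.
split.
- by exists z; split=> //; apply/hs; split; [apply/hw; apply: nat_zero|apply: P0].
- move=> x /hs [/hw xn Px]; have [y hy] := succ_ex x; exists y; split=> //.
  by apply/hs; split; [apply/hw; apply: nat_succ hy|apply: PS hy].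
Qed.

(* [f] witnesses by a recursion on natural numbers that the [n]-fold union of [x] is [v]. *)
Definition iter_union x n v : Prop :=
  exists f, app f n v /\ forall k w, app f k w ->
    (is_setof (fun _ => False) k /\ w = x) \/
    exists j u, app f j u /\ is_succ j k /\ is_setof (fun z => exists y, y ∈ u /\ z ∈ y) w.

Lemma iter_union_zero x z : is_setof (fun _ => False) z -> iter_union x z x.
Proof.
move=> hz; exists (upair (pair z x) (pair z x)); split.
  by rewrite appE in_upair; left.
by move=> k w; rewrite appE in_upair => -[] /pair_inj [-> ->]; left.
Qed.

(** The condition on a witness looks only downwards, from a pair to its predecessor, so adding one
    pair on top keeps it valid. *)
Lemma iter_union_succ x n m v w : iter_union x n v -> is_succ n m ->
  is_setof (fun z => exists y, y ∈ v /\ z ∈ y) w -> iter_union x m w.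
Proof.
move=> [f [fnv hf]] nm hw; have [g [_ hg]] := adjoin_ex f (pair m w).
have fg k u : app f k u -> app g k u by rewrite !appE hg; left.
exists g; split; first by rewrite appE hg; right.
move=> k u; rewrite appE hg -appE => -[/hf [] |/pair_inj [-> ->]].
- by left.
- by move=> [j [u' [/fg ? ?]]]; right; exists j, u'.
- by right; exists n, v; split=> //; apply: fg.
Qed.

(** A witness need not be a function, so uniqueness is an induction inside M: zero is no successor
    and predecessors are unique, hence the last steps of both witnesses start at the same [n]. *)
Lemma iter_union_functional x n v v' : is_nat n ->
  iter_union x n v -> iter_union x n v' -> v = v'.
Proof.
move=> hn; move: n hn v v'.
apply: (nat_ind (P := fun n => forall v v', iter_union x n v -> iter_union x n v' -> v = v')).
- by unfold iter_union; definable.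
- move=> z [_ hz] v v' [f [fv hf]] [g [gv hg]].
  have ns j : ~ is_succ j z by move=> [_ hs]; apply/(hz j)/hs; right.
  case: (hf _ _ fv) => [[_ ->]|[j [u [_ [/ns]]]]] //.
  by case: (hg _ _ gv) => [[_ ->]|[j [u [_ [/ns]]]]].
- move=> n m _ IH nm v v' [f [fv hf]] [g [gv hg]].
  have n0 : ~ is_setof (fun _ => False) m by move=> [_ hm]; apply/(hm n); case: nm => _ ->; right.
  case: (hf _ _ fv) => [[/n0]|[j [u [fu [jm hv]]]]] //.
  case: (hg _ _ gv) => [[/n0]|[j' [u' [gu [jm' hv']]]]] //.
  move: fu gu; rewrite (succ_inj jm nm) (succ_inj jm' nm) => fu gu.
  have e : u = u' by apply: IH; [exists f|exists g].
  by apply: set_ext hv hv' _ => z; rewrite e.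
Qed.

(** [T] is the union of all iterated unions of the singleton of [x]: an element of an element of one
    iterate lies in the next. Replacement over the natural numbers collects the iterates. *)
Lemma transitive_superset_ex x : exists T, transitive T /\ x ∈ T.
Proof.
have [w hw] := omega_ex.
have [|n v v' /hw|s [as_ hs]] := @replacement (iter_union (upair x x)) w.
- by unfold iter_union; definable.
- exact: iter_union_functional.
- have [T [_ hT]] := zfa_union hM s.
  have [w0 [[z [_ hz]] _]] := zfa_infinity hM.
  exists T; split.
  + move=> y u /hT [v [/hs [n [/hw hn nv]] yv]] uy; apply/hT.
    have [v' hv'] := zfa_union hM v; have [m nm] := succ_ex n.
    exists v'; split; last by case: hv' => _ ->; exists y.
    apply/hs; exists m; split; first by apply/hw; apply: nat_succ nm.
    exact: iter_union_succ nv nm hv'.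
  + apply/hT; exists (upair x x); split; last by rewrite in_upair; left.
    by apply/hs; exists z; split; [apply/hw; apply: nat_zero|apply: iter_union_zero].
Qed.

(** Foundation yields minimal elements of sets only, so a minimal counterexample is sought inside a
    transitive set around [x]; transitivity keeps its elements in that set. *)
Lemma mem_ind P : definable1 P -> (forall x, (forall y, y ∈ x -> P y) -> P x) -> forall x, P x.
Proof.
move=> dP IH x; apply: NNPP => nPx; have [T [tT xT]] := transitive_superset_ex x.
have [||y [yT [nPy hy]]] := @foundation_set (fun x => ~ P x) T x _ xT => //.
  by apply: (definable_imp dP); definable.
apply: nPy; apply: IH => z zy; apply: NNPP; apply: (hy z _ zy).
exact: tT zy.
Qed.

Lemma in_TC_refl x : in_TC x x.
Proof. by []. Qed.

Lemma in_TC_mem x y z : in_TC x y -> z ∈ y -> in_TC x z.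
Proof. by move=> h zy t tt xt; apply: (tt _ _ _ zy); apply: h. Qed.

Lemma in_TC_trans x y z : in_TC x y -> in_TC y z -> in_TC x z.
Proof. by move=> h h' t tt xt; apply: h' => //; apply: h. Qed.

(** The right-hand side describes a transitive class containing [x]. Since [in_TC] ranges over sets,
    that class is cut out of a transitive set [T]. *)
Lemma in_TC_inv x y : in_TC x y -> y = x \/ exists u, u ∈ x /\ in_TC u y.
Proof.
have [T [tT xT]] := transitive_superset_ex x.
have [|t [_ ht]] := @separation (fun y => y = x \/ exists u, u ∈ x /\ in_TC u y) T.
  by definable.
move=> /(_ t) h; suff : y ∈ t by move=> /ht [].
apply: h; last by apply/ht; split; [|left].
move=> v z /ht [vT hv] zv; apply/ht; split; first exact: tT zv.
right; case: hv => [e|[u [ux uv]]]; first by exists z; rewrite -e; split=> //; exact: in_TC_refl.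
by exists u; split=> //; apply: in_TC_mem zv.
Qed.

Lemma pure_mem x y : pure x -> y ∈ x -> pure y.
Proof. by move=> px yx z /(in_TC_trans (in_TC_mem (in_TC_refl (x:=x)) yx)) /px. Qed.

Lemma pure_of_mem x : ~ atom x -> (forall y, y ∈ x -> pure y) -> pure x.
Proof. by move=> ax hx y /in_TC_inv [-> //|[u [/hx hu /hu]]]. Qed.

Lemma nat_pure n : is_nat n -> pure n.
Proof.
move: n; apply: (nat_ind (P := pure)); first by definable.
- by move=> z [az hz]; apply: pure_of_mem => // y /hz [].
- move=> n m hn pn [am hm]; apply: pure_of_mem => // y /hm [|-> //].
  exact: pure_mem.
Qed.

(** * The action of permutations of the atoms *)

(** The recursion data of [act] detached from its argument, so that one attempt evaluates the action
    on its whole domain. *)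
Definition attempt p D f : Prop :=
  transitive D /\ is_fun f (el D) (fun _ => True) /\
  forall z w, app f z w ->
    (atom z -> app p z w) /\
    (~ atom z -> is_setof (fun v => exists u, u ∈ z /\ app f u v) w).

Lemma attempt_act p D f x y : attempt p D f -> app f x y -> act p x y.
Proof.
move=> [tD [hf hr]] fxy; exists D, f; do 3?split=> //.
by have [] := fun_dom hf fxy.
Qed.

Lemma act_attempt p x y : act p x y -> exists D f, attempt p D f /\ app f x y.
Proof. by move=> [D [f [tD [_ [hf [hr fxy]]]]]]; exists D, f. Qed.

(** The domain of an attempt is transitive, so an attempt for [x] also evaluates all elements of
    [x]. The set clause is given as two halves because different attempts are not yet known to
    agree. *)
Lemma act_step p x y : act p x y ->
  (atom x -> app p x y) /\
  (~ atom x -> ~ atom y /\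
    (forall v, v ∈ y -> exists u, u ∈ x /\ act p u v) /\
    (forall u, u ∈ x -> exists v, v ∈ y /\ act p u v)).
Proof.
move=> /act_attempt [D [f [hA fxy]]]; have [tD [hf /(_ _ _ fxy) [ha hs]]] := hA.
split=> // /hs [ay hy]; split=> //; split=> [v /hy [u [ux fuv]]|u ux].
- by exists u; split=> //; apply: attempt_act hA fuv.
- have [xD _] := fun_dom hf fxy; have [v fuv] := fun_total hf (tD _ _ xD ux).
  by exists v; split; [apply/hy; exists u|apply: attempt_act hA fuv].
Qed.

Lemma act_functional p : is_sym p -> forall x y y', act p x y -> act p x y' -> y = y'.
Proof.
move=> [hp _].
apply: (mem_ind (P := fun x => forall y y', act p x y -> act p x y' -> y = y')).
  by definable.
move=> x IH y y' /act_step [xa xs] /act_step [xa' xs'].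
case: (classic (atom x)) => [ax|nax]; first exact: fun_functional hp (xa ax) (xa' ax).
have [ay [h1 h2]] := xs nax; have [ay' [h1' h2']] := xs' nax.
apply: (zfa_extensionality hM) => // v; split.
- move=> /h1 [u [ux uv]]; have [v' [v'y uv']] := h2' _ ux.
  by rewrite (IH _ ux _ _ uv uv').
- move=> /h1' [u [ux uv]]; have [v' [v'y uv']] := h2 _ ux.
  by rewrite (IH _ ux _ _ uv uv').
Qed.

Lemma act_set p x y : is_sym p -> ~ atom x -> act p x y ->
  is_setof (fun v => exists u, u ∈ x /\ act p u v) y.
Proof.
move=> hp ax /act_step [_ /(_ ax) [ay [h1 h2]]]; split=> // v; split=> [/h1 //|[u [ux uv]]].
have [v' [v'y uv']] := h2 _ ux.
by rewrite (act_functional hp uv uv').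
Qed.

(** Instead of gluing the attempts for the elements of [x], a new one is built on the set [D] of all
    elements of [T] whose elements already have images; its values come from the one-step relation
    [R]. *)
Lemma act_total p : is_sym p -> forall x, exists y, act p x y.
Proof.
move=> hp; have [hpf _] := hp.
apply: (mem_ind (P := fun x => exists y, act p x y)); first by definable.
move=> x IH; have [T [tT xT]] := transitive_superset_ex x.
have [|D [_ hD]] := @separation (fun y => forall u, u ∈ y -> exists v, act p u v) T.
  by definable.
pose R y v := (atom y -> app p y v) /\ (~ atom y -> is_setof (fun v' => exists u, u ∈ y /\ act p u v') v).
have actR y v : act p y v -> R y v.
  by move=> h; split=> ay; [apply: (proj1 (act_step h))|apply: act_set h].
have Rf y v v' : R y v -> R y v' -> v = v'.
  move=> [h1 h2] [h1' h2']; case: (classic (atom y)) => ay.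
    exact: fun_functional hpf (h1 ay) (h1' ay).
  exact: set_ext (h2 ay) (h2' ay) _.
have dact : definable2 (act p) by definable.
have [||||f [hf appf]] := @fun_of_graph D (el D) (fun _ => True) R => //.
{ by unfold R; definable. }
{ by move=> y v v' _; apply: Rf. }
{ move=> y /hD [_ hy]; case: (classic (atom y)) => ay.
    by have [v ?] := fun_total hpf ay; exists v; split=> //; split.
  have [||s hs] := @replacement (act p) y => //.
    by move=> u v v' _; apply: (act_functional hp).
  by exists s; split=> //; split. }
(* An attempt that evaluates [u] also evaluates the elements of [u], hence [u] belongs to [D]. *)
have tD : transitive D.
  move=> y u /hD [yT hy] uy; apply/hD; split; first exact: tT uy.
  move=> u' u'u; have [v /act_attempt [D' [f' [hA fuv]]]] := hy _ uy.
  have [tD' [hf' _]] := hA; have [uD' _] := fun_dom hf' fuv.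
  have [v' h] := fun_total hf' (tD' _ _ uD' u'u); exists v'; exact: attempt_act hA h.
have xD : x ∈ D by apply/hD.
have [y fxy] := fun_total hf xD; exists y, D, f; do 4!split=> //.
move=> {}z w /appf [/hD [zT hz] [ha hs]]; split=> // az; have [aw hw] := hs az.
split=> // v; rewrite hw; split=> -[u [uz huv]]; exists u; split=> //.
- by apply/appf; split; [apply: tD uz; apply/hD|apply: actR].
- have [v' uv'] := hz _ uz; move/appf: huv => [_ huv].
  by rewrite (Rf _ _ _ huv (actR _ _ uv')).
Qed.

(** Like [pair], a name for rewriting only; inductions on sets must state their claim with the
    relation [act]. *)
Definition img p x : M := epsilon (inhabits x) (act p x).

Lemma actE p x y : is_sym p -> act p x y <-> y = img p x.
Proof.
move=> hp; have h : act p x (img p x) by exact: epsilon_spec (act_total hp x).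
by split=> [h'|-> //]; apply: act_functional h' h.
Qed.

Lemma act_img p x : is_sym p -> act p x (img p x).
Proof. by move=> hp; apply/actE. Qed.

Lemma app_img p a b : is_sym p -> atom a -> app p a b <-> b = img p a.
Proof.
move=> hp aa; have [h _] := act_step (act_img a hp).
by split=> [h'|->]; [exact: fun_functional (proj1 hp) h' (h aa)|exact: h].
Qed.

Lemma img_atom p x : is_sym p -> atom x -> atom (img p x).
Proof. by move=> hp ax; have [_] := fun_dom (proj1 hp) (proj2 (app_img (img p x) hp ax) eq_refl). Qed.

Lemma in_img p x v : is_sym p -> ~ atom x -> v ∈ img p x <-> exists u, u ∈ x /\ v = img p u.
Proof.
move=> hp ax; have [_ ->] := act_set hp ax (act_img x hp).
by split=> -[u [ux /(actE _ _ hp) h]]; exists u.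
Qed.

Lemma img_nonatom p x : is_sym p -> ~ atom x -> ~ atom (img p x).
Proof. by move=> hp ax; case: (act_set hp ax (act_img x hp)). Qed.

Lemma img_ext p x y : is_sym p -> ~ atom x -> ~ atom y ->
  (forall v, v ∈ y <-> exists u, u ∈ x /\ v = img p u) -> img p x = y.
Proof.
move=> hp ax ay h; apply: (zfa_extensionality hM) => // [|v]; first exact: img_nonatom.
by rewrite h in_img.
Qed.

Lemma img_upair p x y : is_sym p -> img p (upair x y) = upair (img p x) (img p y).
Proof.
move=> hp; apply: img_ext => // [||v]; try exact: upair_nonatom.
rewrite in_upair; split=> [[->|->]|[u [/in_upair [->|->] ->]]].
- by exists x; rewrite in_upair; split=> //; left.
- by exists y; rewrite in_upair; split=> //; right.
- by left.
- by right.
Qed.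

Lemma img_pair p x y : is_sym p -> img p (pair x y) = pair (img p x) (img p y).
Proof. by move=> hp; rewrite /pair !img_upair. Qed.

Lemma img_pure p x : is_sym p -> pure x -> img p x = x.
Proof.
move=> hp px; symmetry; apply/actE => //; move: x px.
apply: (mem_ind (P := fun x => pure x -> act p x x)); first by definable.
move=> x IH px; apply/actE => //; have ax := px _ (in_TC_refl (x:=x)).
symmetry; apply: img_ext => // v; split=> [vx|[u [ux ->]]].
- by exists v; split=> //; apply/actE => //; apply: IH vx (pure_mem px vx).
- by rewrite -(proj1 (actE _ _ hp) (IH _ ux (pure_mem px ux))).
Qed.

(** * Composition, inverse and identity of permutations, and their action on sets *)

Lemma app_comp p q r x z : is_comp p q r -> app r x z <-> exists y, app q x y /\ app p y z.
Proof.
move=> [_ h]; rewrite appE h; split=> [[x' [y [z' [qxy [pyz /pairE /pair_inj [-> ->]]]]]]|[y [? ?]]].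
- by exists y.
- by exists x, y, z; rewrite pairE.
Qed.

Lemma app_inv p q x y : is_inv p q -> app q y x <-> app p x y.
Proof.
move=> [_ h]; rewrite appE h; split=> [[x' [y' [pxy /pairE /pair_inj [-> ->]]]]|?] //.
by exists x, y; rewrite pairE.
Qed.

Lemma app_id i x y : is_id i -> app i x y <-> atom x /\ x = y.
Proof.
move=> [_ h]; rewrite appE h; split=> [[a [aa /pairE /pair_inj [-> ->]]]|[ax <-]] //.
by exists x; rewrite pairE.
Qed.

Lemma comp_fun (X Y Z : M -> Prop) p q r :
  is_fun q X Y -> is_fun p Y Z -> is_comp p q r -> is_fun r X Z.
Proof.
move=> hq hp h; split; [by case: h|split] => [s|x Xx].
- case: h => _ h /h [x [y [z [qxy [pyz e]]]]]; exists x, z.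
  by have [? ?] := fun_dom hq qxy; have [? ?] := fun_dom hp pyz.
- have [y qxy] := fun_total hq Xx; have [_ Yy] := fun_dom hq qxy.
  have [z pyz] := fun_total hp Yy; exists z; split.
    by apply/(app_comp _ _ h); exists y.
  move=> z' /(app_comp _ _ h) [y' [qxy' pyz']].
  by move: pyz'; rewrite -(fun_functional hq qxy qxy'); apply: fun_functional hp pyz.
Qed.

Lemma comp_ex D (X Y Z : M -> Prop) p q : (forall x, x ∈ D <-> X x) ->
  is_fun q X Y -> is_fun p Y Z -> exists r, is_comp p q r.
Proof.
move=> hD hq hp.
have [|||r [hr appr]] := @fun_of_graph D X Z (fun x z => exists y, app q x y /\ app p y z) hD.
{ by definable. }
{ move=> x z z' Xx [y [qxy pyz]] [y' [qxy']].
  by rewrite -(fun_functional hq qxy qxy'); apply: fun_functional hp pyz. }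
{ move=> x Xx; have [y qxy] := fun_total hq Xx; have [_ Yy] := fun_dom hq qxy.
  have [z pyz] := fun_total hp Yy; exists z; split; last by exists y.
  by have [] := fun_dom hp pyz. }
exists r; split; first by case: hr.
move=> s; rewrite (in_fun _ hr); split=> [[x [z [-> /appr [_ [y [? ?]]]]]]|[x [y [z [qxy [pyz /pairE ->]]]]]].
- by exists x, y, z; rewrite pairE.
- exists x, z; split=> //; apply/appr; split; last by exists y.
  by have [] := fun_dom hq qxy.
Qed.

Lemma sym_comp p q r : is_sym p -> is_sym q -> is_comp p q r -> is_sym r.
Proof.
move=> [hp [pinj psur]] [hq [qinj qsur]] h; split; first exact: comp_fun hq hp h.
split=> [x x' z|z /psur [y pyz]].
- move=> /(app_comp _ _ h) [y [qxy pyz]] /(app_comp _ _ h) [y' [qxy' pyz']].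
  by apply: qinj qxy _; rewrite (pinj _ _ _ pyz pyz').
- have [_ /qsur [x qxy]] : True /\ atom y by split=> //; have [] := fun_dom hp pyz.
  by exists x; apply/(app_comp _ _ h); exists y.
Qed.

Lemma sym_inv p q : is_sym p -> is_inv p q -> is_sym q.
Proof.
move=> [hp [pinj psur]] h; split; last split.
- split; [by case: h|split] => [s|y ay].
  + case: h => _ h /h [x [y [pxy e]]]; exists y, x.
    by have [? ?] := fun_dom hp pxy.
  + have [x pxy] := psur _ ay; exists x; split; first by apply/(app_inv _ _ h).
    by move=> x' /(app_inv _ _ h); apply: pinj.
- by move=> y y' x /(app_inv _ _ h) pxy /(app_inv _ _ h); apply: fun_functional hp pxy.
- move=> x ax; have [y pxy] := fun_total hp ax; exists y; exact/(app_inv _ _ h).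
Qed.

Lemma sym_id i : is_id i -> is_sym i.
Proof.
move=> h; split; last split.
- split; [by case: h|split] => [s|x ax].
  + by case: h => _ h /h [a [aa e]]; exists a, a.
  + by exists x; split; [apply/(app_id _ _ h)|move=> y /(app_id _ _ h) []].
- by move=> x x' y /(app_id _ _ h) [_ ->] /(app_id _ _ h) [_ ->].
- by move=> x ax; exists x; apply/(app_id _ _ h).
Qed.

Lemma sym_comp_ex p q : is_sym p -> is_sym q -> exists r, is_comp p q r.
Proof.
have [At [_ hAt]] := zfa_set_of_atoms hM.
by move=> [hp _] [hq _]; apply: comp_ex hAt hq hp.
Qed.

Lemma id_ex : exists i, is_id i.
Proof.
have [At [_ hAt]] := zfa_set_of_atoms hM.
have [|x y y' _ <- //|x ax|i [hi appi]] := @fun_of_graph At atom atom (fun x y => x = y) hAt.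
- by definable.
- by exists x.
- exists i; split; first by case: hi.
  move=> s; rewrite (in_fun _ hi); split=> [[x [y [-> /appi [ax <-]]]]|[a [aa /pairE ->]]].
  + by exists x; rewrite pairE.
  + by exists a, a; split=> //; apply/appi.
Qed.

Lemma inv_ex p : is_sym p -> exists q, is_inv p q.
Proof.
have [At [_ hAt]] := zfa_set_of_atoms hM.
move=> [hp [pinj psur]].
have [|x y y' _|x /psur [y pyx]|i [hi appi]] := @fun_of_graph At atom atom (fun x y => app p y x) hAt.
- by definable.
- exact: pinj.
- by exists y; split=> //; have [] := fun_dom hp pyx.
- exists i; split; first by case: hi.
  move=> s; rewrite (in_fun _ hi); split=> [[x [y [-> /appi [ax pyx]]]]|[x [y [pxy /pairE ->]]]].
  + by exists y, x; rewrite pairE.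
  + by exists y, x; split=> //; apply/appi; split=> //; have [] := fun_dom hp pxy.
Qed.

Lemma img_comp p q r x : is_sym p -> is_sym q -> is_comp p q r -> img r x = img p (img q x).
Proof.
move=> hp hq h; have hr := sym_comp hp hq h.
(* The equation between images is rephrased through [act], which makes it a definable property and
   opens it to [mem_ind]. *)
suff H : forall x, forall y z, act q x y -> act p y z -> act r x z.
  by symmetry; apply/actE => //; apply: H; apply: act_img.
clear x; apply: (mem_ind (P := fun x => forall y z, act q x y -> act p y z -> act r x z)).
  by definable.
move=> x IH y z /actE -> // /actE -> //; apply/actE => //.
case: (classic (atom x)) => ax.
  apply/app_img => //; apply/(app_comp _ _ h); exists (img q x).
  by rewrite !app_img //; apply: img_atom.
have aq := img_nonatom hq ax; symmetry.
apply: img_ext => // [|v]; first by exact: img_nonatom.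
have IH' u : u ∈ x -> img r u = img p (img q u).
  by move=> ux; symmetry; apply/actE => //; apply: (IH _ ux); apply: act_img.
rewrite in_img //; split=> [[u [/in_img [] // w [wx ->] ->]]|[u [ux ->]]].
- by exists w; rewrite IH'.
- by exists (img q u); rewrite IH' //; split=> //; apply/in_img => //; exists u.
Qed.

Lemma img_inv p q x : is_sym p -> is_inv p q -> img q (img p x) = x.
Proof.
move=> hp h; have hq := sym_inv hp h.
suff H : forall x, forall y, act p x y -> act q y x.
  by symmetry; apply/actE => //; apply: H; apply: act_img.
clear x; apply: (mem_ind (P := fun x => forall y, act p x y -> act q y x)); first by definable.
move=> x IH y /actE -> //; apply/actE => //; symmetry.
case: (classic (atom x)) => ax.
  by symmetry; apply/app_img => //; [apply: img_atom|apply/(app_inv _ _ h); apply/app_img].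
apply: img_ext => // [|v]; first by exact: img_nonatom.
have IH' u : u ∈ x -> u = img q (img p u) by move=> ux; apply/actE => //; apply: IH ux _ (act_img u hp).
split=> [vx|[u [/in_img [] // w [wx ->] ->]]]; last by rewrite -IH'.
by exists (img p v); split; [apply/in_img => //; exists v|exact: IH'].
Qed.

Lemma img_id i x : is_id i -> img i x = x.
Proof.
move=> h; have hi := sym_id h; symmetry; apply/actE => //; move: x.
apply: (mem_ind (P := fun x => act i x x)); first by definable.
move=> x IH; apply/actE => //; symmetry; case: (classic (atom x)) => ax.
  by symmetry; apply/app_img => //; apply/app_id.
apply: img_ext => // v; split=> [vx|[u [ux]]].
- by exists v; split=> //; apply/actE => //; apply: IH.
- by move/(actE _ _ hi): (IH _ ux) => <- ->.
Qed.

Lemma img_inj p x y : is_sym p -> img p x = img p y -> x = y.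
Proof.
move=> hp e; have [q h] := inv_ex hp.
by rewrite -(img_inv x hp h) e img_inv.
Qed.
(** * Groups and filters *)

(** For finite [E ⊆ S] these groups generate the support filter; a singleton [E] gives the
    stabilizer of one element. *)
Lemma pointwise_stab g E : is_group (el g) ->
  exists K, subgroup (el g) K /\ forall p, p ∈ K <-> p ∈ g /\ forall x, x ∈ E -> act p x x.
Proof.
move=> [gs [[i [hi gi]] [gc gv]]].
have [|K [aK hK]] := @separation (fun p => forall x, x ∈ E -> act p x x) g; first by definable.
exists K; split=> //; split=> //; split=> [p /hK [] //|].
split=> [p /hK [/gs] //|]; split.
  exists i; split=> //; apply/hK; split=> // x _.
  by apply/actE; [apply: gs|rewrite img_id].
split=> [p q /hK [gp hp] /hK [gq hq]|p /hK [gp hp]].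
- have [r [h gr]] := gc _ _ gp gq; exists r; split=> //; apply/hK; split=> // x xE.
  apply/actE; [exact: gs|rewrite (img_comp x (gs _ gp) (gs _ gq) h)].
  rewrite -(proj1 (actE _ _ (gs _ gq)) (hq _ xE)).
  exact/(actE _ _ (gs _ gp))/hp.
- have [q [h gq]] := gv _ gp; exists q; split=> //; apply/hK; split=> // x xE.
  apply/actE; first exact: gs.
  by rewrite {2}(proj1 (actE _ _ (gs _ gp)) (hp _ xE)) (img_inv x (gs _ gp) h).
Qed.

Lemma stab_subgroup g x : is_group (el g) -> exists K, subgroup (el g) K /\ is_setof (stab (el g) x) K.
Proof.
move=> /(@pointwise_stab g (upair x x)) [K [sK hK]]; exists K; split=> //.
split=> [|p]; first by case: sK.
rewrite hK; split=> [[gp h]|[gp h]]; split=> //; first by apply: h; rewrite in_upair; left.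
by move=> y /in_upair [->|->].
Qed.

Lemma finite_empty z : is_setof (fun _ => False) z -> is_finite z.
Proof.
move=> hz; have [az ez] := hz; split=> //; exists z, z; split; first exact: nat_zero.
split; [split=> //; split=> [p|x] /ez []|split=> [x x' y|y /ez []]].
by rewrite appE => /ez [].
Qed.

(** A new [x] receives the index [n], which is fresh because [n ∉ n]; if [x] is already in [D], the
    old enumeration still works. *)
Lemma finite_adjoin D D' x : is_finite D -> is_setof (fun v => v ∈ D \/ v = x) D' -> is_finite D'.
Proof.
move=> [aD [n [f [hn [hf [finj fsur]]]]]] [aD' hD']; split=> //.
case: (classic (x ∈ D)) => xD.
  exists n, f; split=> //.
  have -> : D' = D.
    apply: (zfa_extensionality hM) => // v; rewrite hD'.
    by split=> [[|->]|]; auto.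
  by split.
have [m nm] := succ_ex n; have [am hm] := nm.
have nn u y : app f u y -> u <> n.
  by move=> fuy e; have [] := fun_dom hf fuy; rewrite e => /mem_irrefl.
have [||||h [hh apph]] := @fun_of_graph m (el m) (el D') (fun u v => app f u v \/ u = n /\ v = x) => //.
{ by definable. }
{ move=> u v v' _ [fuv|[-> ->]] [fuv'|[e ->]] //.
  - exact: fun_functional hf fuv fuv'.
  - by case: (nn _ _ fuv).
  - by case: (nn _ _ fuv'). }
{ move=> u /hm [un|->]; last by exists x; split; [apply/hD'; right|right].
  have [v fuv] := fun_total hf un; exists v; split; last by left.
  by apply/hD'; left; have [] := fun_dom hf fuv. }
exists m, h; split; first exact: nat_succ nm.
split=> //; split=> [u u' v /apph [_ [fuv|[-> ->]]] /apph [_ [fuv'|[-> e]]]|v /hD' [/fsur [u fuv]|->]].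
- exact: finj fuv fuv'.
- by case: xD; rewrite -e; have [] := fun_dom hf fuv.
- by case: xD; have [] := fun_dom hf fuv'.
- by [].
- by exists u; apply/apph; split; [apply/hm; left; have [] := fun_dom hf fuv|left].
- by exists n; apply/apph; split; [apply/hm; right|right].
Qed.

Lemma finite_upair x y : is_finite (upair x y).
Proof.
have [w [[z [_ hz]] _]] := zfa_infinity hM.
have [D hD] := adjoin_ex z x; apply: (finite_adjoin (D := D) (x := y)).
  exact: finite_adjoin (finite_empty hz) hD.
split=> [|v]; first exact: upair_nonatom.
case: hz => _ hz; case: hD => _ hD; rewrite in_upair hD.
by split=> [[|]|[[/hz []|]|]]; auto.
Qed.

Lemma filter_inter g F H K : normal_filter (el g) F -> F H -> F K ->
  exists I, F I /\ forall p, p ∈ I -> p ∈ H /\ p ∈ K.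
Proof.
move=> [_ [_ [_ [hF _]]]] FH FK.
have [D|I [[_ hI] FI]] := hF _ (finite_upair H K); first by rewrite in_upair => -[->|->].
exists I; split=> // p /hI [_ h].
by split; apply: h; rewrite in_upair; [left|right].
Qed.

Lemma filter_top g F : ~ atom g -> is_group (el g) -> normal_filter (el g) F -> F g.
Proof.
move=> ag hg [[H FH] [sF [uF _]]]; apply: (uF _ _ FH) => //.
by have [_ []] := sF _ FH.
Qed.

(** The stabilizer of [x] is a subgroup in M above [H], so closure under supergroups applies.
    Symmetry thus reduces to finding one member of the filter that fixes [x]. *)
Lemma symmetric_of_fixed g F H x : is_group (el g) -> normal_filter (el g) F -> F H ->
  (forall p, p ∈ H -> act p x x) -> symmetric (el g) F x.
Proof.
move=> hg [_ [sF [uF _]]] FH h; have [K [sK hK]] := stab_subgroup x hg.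
exists K; split=> //; apply: (uF _ _ FH sK) => p pH; case: hK => _ ->; split; last exact: h.
by have [_ [sH _]] := sF _ FH; apply: sH.
Qed.

Lemma symmetric_pair g F x y : is_group (el g) -> normal_filter (el g) F ->
  symmetric (el g) F x -> symmetric (el g) F y -> symmetric (el g) F (upair x y).
Proof.
move=> hg hF [H [[_ hH] FH]] [K [[_ hK] FK]].
have [I [FI hI]] := filter_inter hF FH FK.
apply: (symmetric_of_fixed hg hF FI) => p /hI [/hH [gp px] /hK [_ py]].
have [sp _] := hg; apply/actE; first exact: sp.
have hp : is_sym p by apply: sp.
rewrite img_upair //; congr upair; exact/actE.
Qed.

Lemma PM_intro (G F : M -> Prop) x : symmetric G F x -> (forall y, y ∈ x -> PM G F y) -> PM G F x.
Proof. by move=> sx h y /in_TC_inv [->|[u [/h hu /hu]]]. Qed.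

Lemma PM_upair g F x y : is_group (el g) -> normal_filter (el g) F ->
  PM (el g) F x -> PM (el g) F y -> PM (el g) F (upair x y).
Proof.
move=> hg hF hx hy; apply: PM_intro; last by move=> z /in_upair [->|->].
by apply: symmetric_pair => //; [apply: hx|apply: hy]; apply: in_TC_refl.
Qed.

Lemma PM_pair g F x y : is_group (el g) -> normal_filter (el g) F ->
  PM (el g) F x -> PM (el g) F y -> PM (el g) F (pair x y).
Proof. by move=> hg hF hx hy; do !apply: PM_upair. Qed.

Lemma PM_pure g F x : ~ atom g -> is_group (el g) -> normal_filter (el g) F ->
  pure x -> PM (el g) F x.
Proof.
move=> ag hg hF px y xy; apply: (symmetric_of_fixed hg hF (filter_top ag hg hF)) => p gp.
have hp : is_sym p by case: hg => + _; apply.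
apply/actE => //; symmetry; apply: img_pure => // z yz; apply: px; exact: in_TC_trans yz.
Qed.

Lemma PM_atom g F a : normal_filter (el g) F -> atom a -> PM (el g) F a.
Proof.
move=> [_ [_ [_ [_ [_ hF]]]]] aa; apply: PM_intro; first exact: hF.
by move=> y /(zfa_atoms_empty hM _ _ aa).
Qed.

(** * Structures on the atoms *)

(** The indices are natural numbers, hence pure and fixed by [p]; the recursive action therefore
    changes only the second coordinate of each pair in [t]. *)
Lemma img_tuple p t t' n : is_sym p -> is_nat n -> is_fun t (el n) atom ->
  is_comp p t t' <-> t' = img p t.
Proof.
move=> hp hn ht; have at_ : ~ atom t by case: ht.
have h v : (exists x y z, app t x y /\ app p y z /\ is_pair x z v) <-> v ∈ img p t.
{ rewrite in_img //; split=> [[x [y [z [txy [pyz /pairE ->]]]]]|[u [/(in_fun _ ht) [x [y [-> txy]]] ->]]];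
    have [xn ay] := fun_dom ht txy; have px := img_pure hp (pure_mem (nat_pure hn) xn).
  - exists (pair x y); split; first exact/appE.
    by rewrite img_pair // px; congr pair; apply/app_img.
  - exists x, y, (img p y); split=> //; split; first exact/app_img.
    by rewrite pairE img_pair // px. }
split=> [[at' ht']|->].
- by symmetry; apply: (zfa_extensionality hM) => // [|v]; [apply: img_nonatom|rewrite ht' h].
- by split=> [|v]; [apply: img_nonatom|rewrite h].
Qed.

Lemma fun_img_tuple p t n : is_sym p -> is_nat n -> is_fun t (el n) atom ->
  is_fun (img p t) (el n) atom.
Proof. by move=> hp hn ht; apply: (comp_fun ht (proj1 hp)); apply/(img_tuple _ hp hn ht). Qed.

Lemma AutE A p : Aut A p <-> is_sym p /\ forall R P n t, app A R P -> is_nat n ->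
  is_fun t (el n) atom -> (t ∈ P <-> img p t ∈ P).
Proof.
split=> -[hp h]; split=> // R P n t; last move=> t'; move=> ARP hn ht.
- by apply: (h _ _ _ _ _ ARP hn ht); apply/(img_tuple _ hp hn ht).
- by move=> /(img_tuple _ hp hn ht) ->; apply: h ARP hn ht.
Qed.

Lemma Aut_group A : exists g, ~ atom g /\ is_group (el g) /\ el g = Aut A.
Proof.
have [At [_ hAt]] := zfa_set_of_atoms hM.
(* A Kuratowski pair of atoms lies in the second power set of the set of atoms, so a permutation
   lies in the third, from which [Aut A] is separated. *)
have [P1 [_ hP1]] := zfa_powerset hM At; have [P2 [_ hP2]] := zfa_powerset hM P1.
have [P3 [_ hP3]] := zfa_powerset hM P2.
have pairP x y : atom x -> atom y -> pair x y ∈ P2.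
  move=> ax ay; apply/hP2; split=> [|u]; first exact: pair_nonatom.
  rewrite in_upair => hu; apply/hP1; case: hu => ->; split; try exact: upair_nonatom;
    by move=> z /in_upair [->|->]; apply/hAt.
have symP p : is_sym p -> p ∈ P3.
  move=> [hp _]; apply/hP3; split=> [|s]; first by case: hp.
  move=> /(in_fun _ hp) [x [y [-> /(fun_dom hp) [ax ay]]]]; exact: pairP.
have [|g [ag hg]] := @separation (Aut A) P3; first by definable.
have {}hg p : p ∈ g <-> Aut A p.
  by rewrite hg; split=> [[]|h] //; split=> //; apply: symP; case: h.
exists g; do 2?split=> //; last first.
  by apply: functional_extensionality => p; apply: propositional_extensionality; exact: hg.
split=> [p /hg [] //|]; split.
  have [i hi] := id_ex; exists i; split=> //; apply/hg/AutE; split; first exact: sym_id.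
  by move=> R P n t _ _ _; rewrite img_id.
split=> [p q /hg /AutE [hp pA] /hg /AutE [hq qA]|p /hg /AutE [hp pA]].
- have [r h] := sym_comp_ex hp hq; exists r; split=> //; apply/hg/AutE; split; first exact: sym_comp h.
  move=> R P n t ARP hn ht; rewrite (img_comp t hp hq h) (qA _ _ _ _ ARP hn ht).
  apply: (pA _ _ _ _ ARP hn); exact: fun_img_tuple.
- have [q h] := inv_ex hp; have hq := sym_inv hp h.
  exists q; split=> //; apply/hg/AutE; split=> // R P n t ARP hn ht.
  rewrite (pA _ _ _ _ ARP hn (fun_img_tuple hq hn ht)).
  (* [img_inv] cancels [q] after [p]; the opposite order follows because [q] acts injectively. *)
  suff -> : img p (img q t) = t by [].
  by apply: (img_inj hq); rewrite img_inv.
Qed.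

(* The language being pure, [p] fixes every symbol and so can only move the predicates of [A]. *)
Lemma img_structure A p : pure_structure A -> is_sym p -> img p A = A <-> Aut A p.
Proof.
move=> [L [[aL hA] pL]] hp; have aA : ~ atom A by case: hA.
have pR R P : app A R P -> img p (pair R P) = pair R (img p P).
  by move=> /(fun_dom hA) [RL _]; rewrite img_pair // (img_pure hp (pure_mem pL RL)).
split=> [pA|/AutE [_ pA]].
- apply/AutE; split=> // R P n t ARP hn ht.
  have [_ [aP _]] := fun_dom hA ARP.
  (* As [p] fixes both [A] and the symbol [R], the image of [P] is again a value of [A] at [R]. *)
  have pP : P = img p P.
    apply: (fun_functional hA ARP).
    rewrite appE -(pR _ _ ARP) -[X in _ ∈ X]pA in_img //.
    by exists (pair R P); split=> //; apply/appE.
  rewrite {2}pP in_img //; split=> [tP|[u [uP /(img_inj hp) ->]]] //.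
  by exists t.
- have pP R P : app A R P -> img p P = P.
  { move=> ARP; have [_ [aP [n [hn hP]]]] := fun_dom hA ARP.
    apply: img_ext => // t; split=> [tP|[u [uP ->]]].
    + have [q h] := inv_ex hp; have hq := sym_inv hp h.
      have e : img p (img q t) = t by apply: (img_inj hq); rewrite img_inv.
      exists (img q t); split=> //; apply/(pA _ _ n _ ARP hn); last by rewrite e.
      by apply: fun_img_tuple => //; apply: hP.
    + exact: (proj1 (pA _ _ _ _ ARP hn (hP _ uP)) uP). }
  apply: img_ext => // v; rewrite (in_fun _ hA).
  split=> [[R [P [-> ARP]]]|[u [/(in_fun _ hA) [R [P [-> ARP]]] ->]]].
  + by exists (pair R P); rewrite (pR _ _ ARP) (pP _ _ ARP) -appE.
  + by exists R, P; rewrite (pR _ _ ARP) (pP _ _ ARP).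
Qed.

(* A finite tuple is supported by the intersection of the stabilizers of its entries. *)
Lemma symmetric_tuple g S n t : ~ atom g -> is_group (el g) ->
  normal_filter (el g) (supp_filter (el g) S) -> is_nat n -> is_fun t (el n) atom ->
  symmetric (el g) (supp_filter (el g) S) t.
Proof.
move=> ag hg hF hn ht.
(* The length [n] may be nonstandard, so a group fixing all entries is found by induction inside
   M. *)
suff [H [FH hH]] : exists H, supp_filter (el g) S H /\
    forall p, p ∈ H -> forall k a, app t k a -> app p a a.
{ apply: (symmetric_of_fixed hg hF FH) => p pH.
  have hp : is_sym p by have [_ [sF _]] := hF; have [_ [sH _]] := sF _ FH; case: hg => + _; apply; apply: sH.
  apply/actE => //; apply/(img_tuple _ hp hn ht); split; first by case: ht.
  move=> v; rewrite (in_fun _ ht).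
  split=> [[k [a [-> tka]]]|[k [a [b [tka [pab /pairE ->]]]]]].
  - by exists k, a, a; rewrite pairE; do 2!split=> //; apply: hH tka.
  - by exists k, a; rewrite (fun_functional (proj1 hp) pab (hH _ pH _ _ tka)). }
move: n hn t ht.
apply: (nat_ind (P := fun n => forall t, is_fun t (el n) atom -> exists H, supp_filter (el g) S H /\
    forall p, p ∈ H -> forall k a, app t k a -> app p a a)).
- by definable.
- move=> z [_ hz] t ht; exists g; split; first exact: filter_top.
  by move=> p _ k a /(fun_dom ht) [/hz].
- move=> n m hn IH [_ hm] t ht.
  have [a0 ta0] : exists a, app t n a by apply: (fun_total ht); apply/hm; right.
  (* [t0] is [t] without its last entry [a0]; intersecting its group with the stabilizer of [a0]
     handles [t]. *)
  have [||||t0 [ht0 appt0]] := @fun_of_graph n (el n) atom (app t) => //.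
  { by definable. }
  { by move=> x y y' _; apply: fun_functional ht. }
  { move=> k kn; have [a tka] : exists a, app t k a by apply: (fun_total ht); apply/hm; left.
    by exists a; split=> //; have [] := fun_dom ht tka. }
  have [H [FH hH]] := IH _ ht0.
  have [_ [_ [_ [_ [_ Fa]]]]] := hF; have [_ aa0] := fun_dom ht ta0.
  have [K [[_ hK] FK]] := Fa _ aa0; have [I [FI hI]] := filter_inter hF FH FK.
  exists I; split=> // p /hI [pH /hK [gp pa0]] k a tka.
  have [/hm [kn|e] _] := fun_dom ht tka; first by apply: (hH _ pH k); apply/appt0.
  move: tka; rewrite e => tna; rewrite (fun_functional ht tna ta0).
  by have [h _] := act_step pa0; apply: h.
Qed.

(** Hereditary symmetry is checked along the pairs that make up [A]: symbols and indices are pure,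
    atoms are symmetric by normality, and [A] and its predicates are fixed by all of [g]. *)
Lemma PM_structure g A S : pure_structure A -> ~ atom g -> is_group (el g) -> el g = Aut A ->
  normal_filter (el g) (supp_filter (el g) S) -> PM (el g) (supp_filter (el g) S) A.
Proof.
move=> hA ag hg gA hF; have [L [[aL fA] pL]] := hA.
have gE p : p ∈ g -> Aut A p by rewrite -gA.
apply: PM_intro => [|v /(in_fun _ fA) [R [P [-> ARP]]]].
  apply: (symmetric_of_fixed hg hF (filter_top ag hg hF)) => p /gE pA.
  by apply/actE; [case: pA|symmetry; apply/img_structure => //; case: pA].
have [RL [aP [n [hn hP]]]] := fun_dom fA ARP.
apply: PM_pair => //; first by apply: PM_pure => //; apply: pure_mem RL.
apply: PM_intro => [|t tP].
  apply: (symmetric_of_fixed hg hF (filter_top ag hg hF)) => p /gE pA.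
  have hp : is_sym p by case: pA.
  apply/actE => //; apply: (fun_functional fA ARP); rewrite appE.
  have pAA : img p A = A by apply/img_structure.
  rewrite -pAA; apply/in_img => //; first by case: fA.
  exists (pair R P); split; first exact/appE.
  by rewrite img_pair // (img_pure hp (pure_mem pL RL)).
have ht := hP _ tP.
apply: PM_intro => [|s /(in_fun _ ht) [k [a [-> tka]]]]; first exact: symmetric_tuple hn ht.
have [kn aa] := fun_dom ht tka.
apply: PM_pair => //; last exact: PM_atom.
by apply: PM_pure => //; apply: pure_mem kn; apply: nat_pure.
Qed.

(* Below the stabilizer of [A] in [g'], which is a subgroup of [g], the supports for [g] also work for [g']. *)
Lemma symmetric_transfer g g' A S x : pure_structure A -> el g = Aut A -> is_group (el g') ->
  normal_filter (el g') (supp_filter (el g') S) -> symmetric (el g') (supp_filter (el g') S) A ->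
  symmetric (el g) (supp_filter (el g) S) x -> symmetric (el g') (supp_filter (el g') S) x.
Proof.
move=> hA gA hg' hF' [H [[_ hH] FH]] [X [[_ hX] [_ [E [fE [ES hE]]]]]].
have [K [sK hK]] := pointwise_stab E hg'.
have FK : supp_filter (el g') S K.
  split=> //; exists E; do 2!split=> //; move=> p gp h; apply/hK; split=> // y /h [] //.
have [I [FI hI]] := filter_inter hF' FH FK.
apply: (symmetric_of_fixed hg' hF' FI) => p /hI [/hH [gp pA] /hK [_ pE]].
have hp : is_sym p by case: hg' => + _; apply.
(* Fixing [A] moves [p] from [g'] into [g], where [E] is known to support [x]. *)
have gp' : el g p by rewrite gA; apply/img_structure => //; symmetry; apply/actE.
by have /hX [] : p ∈ X by apply: hE => // y yE; split=> //; apply: pE.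
Qed.

End SetTheory.

Theorem mainTheorem3 (M : structure) (hM : ZFA M)
    (S : M) (hS : set_of_supports S)
    (A A' : M) (hA : pure_structure A) (hA' : pure_structure A') :
  let N : M -> Prop := PM (Aut A) (supp_filter (Aut A) S) in
  let N' : M -> Prop := PM (Aut A') (supp_filter (Aut A') S) in
  (N' A /\ N A') <-> (forall x : M, N x <-> N' x).
Proof.
case: hS => _ hS.
have [g [ag [hg gA]]] := Aut_group hM A; have [g' [ag' [hg' gA']]] := Aut_group hM A'.
have hF := hS _ ag hg; have hF' := hS _ ag' hg'.
rewrite -gA -gA' /=; split=> [[NA NA'] x|NN'].
(* Membership in either model is symmetry of every [y] in the transitive closure, so the transfer is
   applied to each [y] separately. *)
- split=> h y /h.
  + exact: symmetric_transfer hA gA hg' hF' (NA _ (in_TC_refl (x:=A))).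
  + exact: symmetric_transfer hA' gA' hg hF (NA' _ (in_TC_refl (x:=A'))).
- by split; apply/NN'; apply: PM_structure.
Qed.
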